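(* Let $\phi$ be a unary strong normal form different from $\top$, written as \[ \phi=\bigwedge_{j\in J}\langle a_j\rangle\phi_j\land \bigwedge_{b\in A^l}[b]\bigvee_{k\in K_b}\psi^k_b , \] where $a_j\in A^r$ and every $\phi_j$ and every $\psi^k_b$ is a unary strong normal form. Then $\phi$ is represented by the process term defined recursively by \begin{eqnarray*} \theta(\phi) & = & \sum_{j\in J}a_j.\theta(\phi_j)+\sum_{b\in A^l}\sum_{k\in K_b}b.\theta(\psi^k_b),\quad\textrm{if $\phi\neq\top$} \\ \theta(\top) & = & \omega , \end{eqnarray*} i.e. for all $q\in\mathcal{P}$: $q\models\phi$ iff $\theta(\phi)\lesssim_{cc} q$. In particular $\phi$ is the characteristic formula for $\theta(\phi)$ (up to logical equivalence). Although the recursive definition of $\theta(\phi)$ formally contains a summand for each $b\in A^l$, only those $b$ with $K_b\neq\emptyset$ actually appear as summands of $\theta(\phi)$.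
   Context: Labelled transition systems $({\bf P},A,\to)$ with a finite set of actions $A=A^l\uplus A^r$ (no bivariant actions). A covariant-contravariant simulation is a relation $R$ such that whenever $p\,R\,q$: for all $a\in A^r$ and $p\xrightarrow{a}p'$ there is $q\xrightarrow{a}q'$ with $p'\,R\,q'$; and for all $a\in A^l$ and $q\xrightarrow{a}q'$ there is $p\xrightarrow{a}p'$ with $p'\,R\,q'$. $p\lesssim_{cc} q$ iff some such $R$ relates them. Process terms $\mathcal{P}$: $p::=0\mid\omega\mid a.p\mid p+p$ ($a\in A$), with rules $\omega\xrightarrow{b}\omega$ for all $b\in A^l$, $a.p\xrightarrow{a}p$, and $+$ as nondeterministic choice. The covariant-contravariant modal logic has syntax $\varphi::=\bot\mid\top\mid\varphi\land\varphi\mid\varphi\lor\varphi\mid[b]\varphi\mid\langle a\rangle\varphi$ ($a\in A^r$, $b\in A^l$), with $p\models[b]\varphi$ iff $p'\models\varphi$ for all $p\xrightarrow{b}p'$ and $p\models\langle a\rangle\varphi$ iff $p'\models\varphi$ for some $p\xrightarrow{a}p'$. A formula $\phi$ is represented by a process $p$ if for all $q\in\mathcal{P}$, $q\models\phi$ iff $p\lesssim_{cc}q$. A characteristic formula for $p$ is a $\phi$ with $p\models\phi$ and $q\models\phi\Rightarrow p\lesssim_{cc}q$ for all $q$. A formula is in strong normal form if it is a finite disjunction of unary strong normal forms; a formula is in unary strong normal form if it is $\top$ or of the form $\bigwedge_{j\in J}\langle a_j\rangle\phi_j\land\bigwedge_{b\in A^l}[b]\psi_b$ with each $\phi_j$ in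 unary strong normal form and each $\psi_b$ in strong normal form (equivalently $\psi_b=\bigvee_{k\in K_b}\psi^k_b$ with unary strong normal forms $\psi^k_b$). *)

(* Defs.v *)
From mathcomp Require Import all_boot.

Set Implicit Arguments.
Unset Strict Implicit.
Unset Printing Implicit Defensive.

(* Al and Ar are the sets of contravariant and covariant actions; the whole
   set of actions is their disjoint union Al + Ar, so that [inl b] and [inr a]
   are the actions b of A^l and a of A^r. *)

Section Semantics.
Variables (Al Ar : finType) (S : Type) (step : S -> Al + Ar -> S -> Prop).

Definition cc_simulation (R : S -> S -> Prop) : Prop :=
  forall p q, R p q ->
    (forall (a : Ar) p', step p (inr a) p' ->
       exists2 q', step q (inr a) q' & R p' q') /\
    (forall (b : Al) q', step q (inl b) q' ->
       exists2 p', step p (inl b) p' & R p' q').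

Definition cc_le (p q : S) : Prop :=
  exists2 R, cc_simulation R & R p q.

End Semantics.

Inductive formula (Al Ar : finType) : Type :=
| Bot
| Top
| And of formula Al Ar & formula Al Ar
| Or of formula Al Ar & formula Al Ar
| Box of Al & formula Al Ar
| Dia of Ar & formula Al Ar.

Arguments Bot {Al Ar}.
Arguments Top {Al Ar}.
Arguments Box {Al Ar}.
Arguments Dia {Al Ar}.

Fixpoint sat (Al Ar : finType) (S : Type) (step : S -> Al + Ar -> S -> Prop)
    (p : S) (phi : formula Al Ar) : Prop :=
  match phi with
  | Bot => False
  | Top => True
  | And phi1 phi2 => sat step p phi1 /\ sat step p phi2
  | Or phi1 phi2 => sat step p phi1 \/ sat step p phi2
  | Box b psi => forall p', step p (inl b) p' -> sat step p' psi
  | Dia a psi => exists2 p', step p (inr a) p' & sat step p' psi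
  end.

Inductive proc (Al Ar : finType) : Type :=
| Zero
| Omega
| Pre of Al + Ar & proc Al Ar
| Plus of proc Al Ar & proc Al Ar.

Arguments Zero {Al Ar}.
Arguments Omega {Al Ar}.

Inductive trans (Al Ar : finType) :
    proc Al Ar -> Al + Ar -> proc Al Ar -> Prop :=
| trans_omega (b : Al) : trans Omega (inl b) Omega
| trans_pre x p : trans (Pre x p) x p
| trans_plusl x p p' q : trans p x p' -> trans (Plus p q) x p'
| trans_plusr x p q q' : trans q x q' -> trans (Plus p q) x q'.

Section Representation.
Variables (Al Ar : finType).
Implicit Types (phi chi : formula Al Ar) (p : proc Al Ar).

Definition represented phi p : Prop :=
  forall q : proc Al Ar, sat (@trans Al Ar) q phi <-> cc_le (@trans Al Ar) p q.

Definition characteristic phi p : Prop :=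
  sat (@trans Al Ar) p phi /\
  (forall q : proc Al Ar, sat (@trans Al Ar) q phi -> cc_le (@trans Al Ar) p q).

Definition logically_equivalent phi chi : Prop :=
  forall q : proc Al Ar, sat (@trans Al Ar) q phi <-> sat (@trans Al Ar) q chi.

End Representation.

(* Finite conjunctions, disjunctions and sums; the empty ones are Top, Bot and
   Zero, and a nonempty one ends with that unit. *)
Definition bigAnd (Al Ar : finType) (s : seq (formula Al Ar)) : formula Al Ar :=
  foldr (@And Al Ar) Top s.
Definition bigOr (Al Ar : finType) (s : seq (formula Al Ar)) : formula Al Ar :=
  foldr (@Or Al Ar) Bot s.
Definition bigPlus (Al Ar : finType) (s : seq (proc Al Ar)) : proc Al Ar :=
  foldr (@Plus Al Ar) Zero s.

(* Unary strong normal forms, kept as the indexed data from which the formula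
   (usnf_formula) is written: UNode J K stands for
     /\_((a, phi) in J) <a> phi  /\  /\_(b in A^l) [b] \/_(psi in K b) psi.
   The list K b is the strong normal form under [b]. *)
Inductive usnf (Al Ar : finType) : Type :=
| UTop
| UNode (J : seq (Ar * usnf Al Ar)) (K : Al -> seq (usnf Al Ar)).

Arguments UTop {Al Ar}.

Fixpoint usnf_formula (Al Ar : finType) (u : usnf Al Ar) : formula Al Ar :=
  match u with
  | UTop => Top
  | UNode J K =>
      And (bigAnd [seq Dia j.1 (usnf_formula j.2) | j <- J])
          (bigAnd [seq Box b (bigOr [seq usnf_formula psi | psi <- K b])
                  | b <- enum Al])
  end.

Fixpoint theta (Al Ar : finType) (u : usnf Al Ar) : proc Al Ar :=
  match u with
  | UTop => Omega
  | UNode J K =>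
      Plus (bigPlus [seq Pre (inr j.1) (theta j.2) | j <- J])
           (bigPlus [seq bigPlus [seq Pre (inl b) (theta psi) | psi <- K b]
                    | b <- enum Al])
  end.

Fixpoint summand (Al Ar : finType) (r p : proc Al Ar) : Prop :=
  r = p \/
  match p with
  | Plus p1 p2 => summand r p1 \/ summand r p2
  | _ => False
  end.

(* Main.v *)
(* The largest covariant-contravariant simulation is a fixed point of its
   defining clauses, and read at p = theta(phi) these clauses are literally the
   conjuncts of phi: the a-derivatives of theta(phi) are the theta(phi_j) with
   a_j = a, and its b-derivatives are the theta(psi_b^k).  Structural induction
   on phi then gives representability, the case phi = Top holding because Omega
   lies below every process.  A characteristic formula of p is determined up to
   equivalence since satisfaction of any formula is preserved upwards. *)

Require Import Defs.
From mathcomp Require Import all_boot.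
From Stdlib Require List.

Set Implicit Arguments.
Unset Strict Implicit.
Unset Printing Implicit Defensive.

(** Lists of [usnf] are not lists over an [eqType], so membership is [List.In] throughout; this
    bridge serves for [enum Al]. *)
Lemma In_mem (T : eqType) (x : T) (s : seq T) : x \in s -> List.In x s.
Proof.
elim: s => [|y s IHs] //=; rewrite inE => /orP[/eqP->|/IHs]; first by left.
by right.
Qed.

Section Simulation.
Variables (Al Ar : finType) (S : Type) (step : S -> Al + Ar -> S -> Prop).
Implicit Types p q : S.

Lemma cc_le_simulation : cc_simulation step (cc_le step).
Proof.
move=> p q [R simR Rpq]; have [covR contraR] := simR p q Rpq.
split=> [a p' /covR | b q' /contraR] [r' stepr Rr]; exists r' => //; by exists R.
Qed.

Lemma cc_le_unfold p q :
  cc_le step p q <->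
  (forall (a : Ar) p', step p (inr a) p' ->
     exists2 q', step q (inr a) q' & cc_le step p' q') /\
  (forall (b : Al) q', step q (inl b) q' ->
     exists2 p', step p (inl b) p' & cc_le step p' q').
Proof.
split; first exact: cc_le_simulation.
move=> clauses.
(* Similarity is itself a simulation, and it remains one after adding the single pair [(p, q)],
   whose derivatives are matched within [cc_le]. *)
exists (fun r s => (r = p /\ s = q) \/ cc_le step r s); last by left.
move=> r s rs.
have [cov contra] :
    (forall (a : Ar) p', step r (inr a) p' ->
       exists2 q', step s (inr a) q' & cc_le step p' q') /\
    (forall (b : Al) q', step s (inl b) q' ->
       exists2 p', step r (inl b) p' & cc_le step p' q').
  by case: rs => [[-> ->] // | /cc_le_simulation].
split=> [a p' /cov | b q' /contra] [r' stepr le]; exists r' => //; by right.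
Qed.

(** Diamonds travel from [p] to [q] by the covariant clause; for a box, a move of [q] is traced back
    to one of [p] by the contravariant clause. *)
Lemma sat_cc_le (phi : formula Al Ar) p q :
  cc_le step p q -> sat step p phi -> sat step q phi.
Proof.
elim: phi p q => [||f IHf g IHg|f IHf g IHg|b f IHf|a f IHf] p q le_pq //=.
- by case=> /(IHf _ _ le_pq) ? /(IHg _ _ le_pq).
- by case=> [/(IHf _ _ le_pq)|/(IHg _ _ le_pq)]; [left | right].
- move=> satp q' stepq.
  have [_ /(_ b q' stepq)[p' stepp le']] := cc_le_simulation le_pq.
  exact: IHf le' (satp _ stepp).
- case=> p' stepp satp.
  have [/(_ a p' stepp)[q' stepq le'] _] := cc_le_simulation le_pq.
  by exists q' => //; apply: IHf satp.
Qed.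

Lemma sat_bigAnd (I : Type) (f : I -> formula Al Ar) (s : seq I) p :
  sat step p (bigAnd [seq f i | i <- s]) <->
  forall i, List.In i s -> sat step p (f i).
Proof.
elim: s => [|i s IHs] //=; rewrite {}IHs; split=> [[fi fs] j [<-|/fs]|fs] //.
by split=> [|j js]; apply: fs; [left | right].
Qed.

Lemma sat_bigOr (I : Type) (f : I -> formula Al Ar) (s : seq I) p :
  sat step p (bigOr [seq f i | i <- s]) <->
  exists2 i, List.In i s & sat step p (f i).
Proof.
elim: s => [|i s IHs] /=; first by split=> [|[]].
rewrite {}IHs; split=> [[fi|[j js fj]]|[j [<-|js] fj]].
- by exists i; first left.
- by exists j; first right.
- by left.
- by right; exists j.
Qed.

(** Brings satisfaction to the two-clause shape of [cc_le_unfold]. *)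
Lemma sat_usnf (J : seq (Ar * usnf Al Ar)) (K : Al -> seq (usnf Al Ar)) q :
  sat step q (usnf_formula (UNode J K)) <->
  (forall a u, List.In (a, u) J ->
     exists2 q', step q (inr a) q' & sat step q' (usnf_formula u)) /\
  (forall b q', step q (inl b) q' ->
     exists2 u, List.In u (K b) & sat step q' (usnf_formula u)).
Proof.
rewrite /= !sat_bigAnd; split=> -[dia box]; split.
- by move=> a u /dia.
- move=> b q' stepq; apply/sat_bigOr; apply: box stepq.
  by apply: In_mem; rewrite mem_enum.
- by case=> a u /dia.
- by move=> b _ q' /box /sat_bigOr.
Qed.

End Simulation.

Section Processes.
Variables Al Ar : finType.
Implicit Types (p q : proc Al Ar) (u : usnf Al Ar).
Implicit Types (J : seq (Ar * usnf Al Ar)) (K : Al -> seq (usnf Al Ar)).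

(* The generated principle gives no induction hypothesis for the members of
   the lists J and K b. *)
Lemma usnf_nested_ind (P : usnf Al Ar -> Prop) :
  P UTop ->
  (forall J K,
     (forall a u, List.In (a, u) J -> P u) ->
     (forall b u, List.In u (K b) -> P u) -> P (UNode J K)) ->
  forall u, P u.
Proof.
move=> PTop PNode; fix IH 1; case=> [|J K]; first exact PTop.
refine (PNode J K _ _).
(* An inner recursion on the list reaches its entries as subterms of the node, which keeps the calls
   to [IH] guarded. *)
- elim: J => [a u []|[a' u'] J IHJ a u [[_ <-]|uJ]]; first exact (IH u').
  exact (IHJ a u uJ).
- move=> b; elim: (K b) => [u []|u' s IHs u [<-|us]]; first exact (IH u').
  exact (IHs u us).
Qed.

(** [Omega] has no covariant move to be matched and answers every contravariant one by its loop. *)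
Lemma cc_le_Omega q : cc_le (@trans Al Ar) Omega q.
Proof.
exists (fun p _ => p = Omega) => // p {}q ->; split=> [a p' tr|b q' _].
  by inversion tr.
by exists Omega => //; apply: trans_omega.
Qed.

Section Additive.
(* Q stands for "has a given transition" or "has a given summand". *)
Variable Q : proc Al Ar -> Prop.
Hypothesis Q_Zero : ~ Q Zero.
Hypothesis Q_Plus : forall p q, Q (Plus p q) <-> Q p \/ Q q.

Lemma additive_bigPlus (I : Type) (f : I -> proc Al Ar) (s : seq I) :
  Q (bigPlus [seq f i | i <- s]) <-> exists2 i, List.In i s & Q (f i).
Proof.
elim: s => [|i s IHs] /=; first by split=> [|[]].
rewrite Q_Plus {}IHs; split=> [[fi|[j js fj]]|[j [<-|js] fj]].
- by exists i; first left.
- by exists j; first right.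
- by left.
- by right; exists j.
Qed.

(** An action [b] with empty [K b] contributes only [Zero], where [Q] fails, and so drops out. *)
Lemma additive_theta J K :
  Q (theta (UNode J K)) <->
  (exists a, exists2 u, List.In (a, u) J & Q (Pre (inr a) (theta u))) \/
  (exists b, exists2 u, List.In u (K b) & Q (Pre (inl b) (theta u))).
Proof.
rewrite /= Q_Plus !additive_bigPlus; split=> [[[[a u]]|[b _]]|[[a [u]]|[b [u]]]].
- by left; exists a, u.
- by rewrite additive_bigPlus => ?; right; exists b.
- by left; exists (a, u).
- move=> uK Qu; right; exists b; first by apply: In_mem; rewrite mem_enum.
  by apply/additive_bigPlus; exists u.
Qed.

End Additive.

Lemma trans_Zero x p' : ~ trans (@Zero Al Ar) x p'.
Proof. by move=> tr; inversion tr. Qed.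

Lemma trans_Plus x p' p q :
  trans (Plus p q) x p' <-> trans p x p' \/ trans q x p'.
Proof.
split=> [tr|[]]; [|exact: trans_plusl|exact: trans_plusr].
by inversion tr; subst; [left | right].
Qed.

Lemma trans_Pre x y p p' : trans (Pre y p) x p' <-> x = y /\ p' = p.
Proof.
by split=> [tr|[-> ->]]; [inversion tr | apply: trans_pre].
Qed.

Lemma trans_theta_inr J K a p' :
  trans (theta (UNode J K)) (inr a) p' <->
  exists2 u, List.In (a, u) J & p' = theta u.
Proof.
rewrite (additive_theta (@trans_Zero _ _) (trans_Plus _ _)).
split=> [[[c [u uJ]]|[b [u uK]]]|[u uJ ->]].
- by case/trans_Pre=> -[ac] ->; exists u; rewrite ?ac.
- by case/trans_Pre.
- by left; exists a, u => //; apply: trans_pre.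
Qed.

Lemma trans_theta_inl J K b p' :
  trans (theta (UNode J K)) (inl b) p' <->
  exists2 u, List.In u (K b) & p' = theta u.
Proof.
rewrite (additive_theta (@trans_Zero _ _) (trans_Plus _ _)).
split=> [[[a [u uJ]]|[c [u uK]]]|[u uK ->]].
- by case/trans_Pre.
- by case/trans_Pre=> -[bc] ->; exists u; rewrite ?bc.
- by right; exists b, u => //; apply: trans_pre.
Qed.

Lemma summand_theta_inl J K b r :
  summand (Pre (inl b) r) (theta (UNode J K)) <->
  exists2 u, List.In u (K b) & r = theta u.
Proof.
(* Having this prefix as a summand is additive because a prefix is neither [Zero] nor a sum. *)
rewrite (@additive_theta (summand (Pre (inl b) r))) /=; last first.
- by move=> p q; split=> [[]|]; last right.
- by case.
split=> [[[a [u _ [|]]]|[c [u uK [|]]]]|[u uK ->]] //.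
- by case=> bc ->; exists u; rewrite ?bc.
- by right; exists b, u => //; left.
Qed.

Lemma represented_theta u : represented (usnf_formula u) (theta u).
Proof.
elim/usnf_nested_ind: u => [|J K IHJ IHK] q.
  by split=> // _; apply: cc_le_Omega.
(* The clauses are matched one by one; the induction hypothesis exchanges satisfaction of the
   formula of [u] for lying above [theta u]. *)
rewrite sat_usnf cc_le_unfold; split=> -[cov contra]; split.
- move=> a p' /trans_theta_inr[u uJ ->].
  have [q' stepq satq] := cov a u uJ.
  by exists q' => //; apply/(IHJ _ _ uJ).
- move=> b q' /contra[u uK satq]; exists (theta u).
    by apply/trans_theta_inl; exists u.
  by apply/(IHK _ _ uK).
- move=> a u uJ; have [|q' stepq le] := cov a (theta u).
    by apply/trans_theta_inr; exists u.
  by exists q' => //; apply/(IHJ _ _ uJ).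
- move=> b q' /contra[_ /trans_theta_inl[u uK ->] le].
  by exists u => //; apply/(IHK _ _ uK).
Qed.

Lemma cc_le_refl p : cc_le (@trans Al Ar) p p.
Proof. by exists eq => // r _ <-; split=> [a r'|b r']; exists r'. Qed.

(** By reflexivity [p] is among the processes above [p]. *)
Lemma represented_characteristic phi p : represented phi p -> characteristic phi p.
Proof.
by move=> rep; split=> [|q]; [apply/rep; apply: cc_le_refl | move/rep].
Qed.

(** Both formulas hold exactly above [p]: for [chi], minimality gives one direction and upward
    preservation from [p] the other. *)
Lemma characteristic_equivalent phi chi p :
  represented phi p -> characteristic chi p -> logically_equivalent chi phi.
Proof.
move=> rep [satp minp] q; split=> [/minp/rep //|/rep le_pq].
exact: sat_cc_le le_pq satp.
Qed.

End Processes.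

Theorem theorem12 (Al Ar : finType)
    (J : seq (Ar * usnf Al Ar)) (K : Al -> seq (usnf Al Ar)) :
  let phi := usnf_formula (UNode J K) in
  let p := theta (UNode J K) in
  [/\ represented phi p,
      characteristic phi p,
      forall chi : formula Al Ar,
        characteristic chi p -> logically_equivalent chi phi
    & forall b : Al,
        (exists r : proc Al Ar, summand (Pre (inl b) r) p) <-> K b <> [::]].
Proof.
move=> phi p; have rep : represented phi p by apply: represented_theta.
split=> //.
- exact: represented_characteristic.
- by move=> chi; apply: characteristic_equivalent.
move=> b; split=> [[r /summand_theta_inl[u uK _]] Kb0|]; first by rewrite Kb0 in uK.
(* The head [u] of a nonempty [K b] supplies the summand. *)
case Kb: (K b) => [//|u s] _; exists (theta u); apply/summand_theta_inl.
by exists u => //; rewrite Kb; left.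
Qed.
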